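(* Let $f_0\in Y$, $f_0\ge0$, with $\int_{\mathbb R^3}f_0\,dv=1$ and $\mathcal I(f_0|\mathcal M)<\infty$, and let $f(t)=Z_Y(t)f_0$. Then the map $t\mapsto\mathcal I(f(t)|\mathcal M)$ is nonincreasing on $[0,\infty)$ (i.e. $\frac{d}{dt}\mathcal I(f(t)|\mathcal M)\le0$).
   Context: Fix masses $m,m_1>0$, a constant restitution coefficient $\epsilon\in(0,1)$, a bulk velocity $u_1\in\mathbb R^3$ and a temperature $\vartheta_1>0$. Let $\mathcal M_1(v)=\big(\frac{m_1}{2\pi\vartheta_1}\big)^{3/2}\exp\big(-\frac{m_1|v-u_1|^2}{2\vartheta_1}\big)$, $\alpha=\frac{m_1}{m+m_1}$, $\beta=\frac{1-\epsilon}{2}$, $\gamma=\alpha\frac{1-\beta}{1-2\beta}$, $\bar\gamma=(1-\alpha)\frac{1-\beta}{1-2\beta}$, $\vartheta^\#=\frac{(1-\alpha)(1-\beta)}{1-\alpha(1-\beta)}\vartheta_1$, $\mathcal M(v)=\big(\frac{m}{2\pi\vartheta^\#}\big)^{3/2}\exp\big(-\frac{m|v-u_1|^2}{2\vartheta^\#}\big)$. For $v,w\in\mathbb R^3$, $n\in\mathbb S^2$, $q=v-w$, let $v_\star=v-2\gamma(q\cdot n)n$, $w_\star=w+2\bar\gamma(q\cdot n)n$, $\sigma(v)=\int_{\mathbb R^3\times\mathbb S^2}|q\cdot n|\mathcal M_1(w)\,dw\,dn$, and $Q^+f(v)=\epsilon^{-2}\int_{\mathbb R^3\times\mathbb S^2}|q\cdot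 n|f(v_\star)\mathcal M_1(w_\star)\,dw\,dn$. Let $Y=L^1(\mathbb R^3,dv)$ and let $(Z_Y(t))_{t\ge0}$ be the minimal positive contraction $C_0$-semigroup on $Y$ whose generator extends the operator $f\mapsto-\sigma f+Q^+f$ defined on $\{f\in Y:\sigma f\in Y\}$ (the semigroup solving the space-homogeneous linear inelastic Boltzmann equation $\partial_tf=Q^+f-\sigma f$). For nonnegative $f,g\in Y$, the information is $\mathcal I(f|g)=\int_{\mathbb R^3}\big(f\ln f-f\ln g\big)dv$, with conventions $0\ln0=0$ and $x\ln0=-\infty$ for $x>0$. *)

(* Defs.v *)
From mathcomp Require Import all_boot all_order all_algebra.
From mathcomp Require Import all_classical all_reals all_analysis.
Set Implicit Arguments. Unset Strict Implicit. Unset Printing Implicit Defensive.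
Import Order.TTheory GRing.Theory Num.Theory.
Local Open Scope classical_set_scope.
Local Open Scope ring_scope.

Section Defs.
Variable R : realType.

Definition V := (R * R * R)%type.
Definition leb := (@lebesgue_measure R).
Definition leb3 := ((leb \x leb) \x leb)%E.

Definition vec (a b c : R) : V := (a, b, c).
Definition vadd (x y : V) : V := vec (x.1.1 + y.1.1) (x.1.2 + y.1.2) (x.2 + y.2).
Definition vscale (a : R) (x : V) : V := vec (a * x.1.1) (a * x.1.2) (a * x.2).
Definition vsub (x y : V) : V := vadd x (vscale (-1) y).
Definition dot (x y : V) : R := x.1.1 * y.1.1 + x.1.2 * y.1.2 + x.2 * y.2.
Definition nrm2 (x : V) : R := dot x x.

(** Integration over the unit sphere S^2 against its surface measure dn,
    written in spherical coordinates: dn = sin th dth dph. *)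
Definition sph (th ph : R) : V := vec (sin th * cos ph) (sin th * sin ph) (cos th).
Definition sphere_int (g : V -> \bar R) : \bar R :=
  (\int[leb]_(th in `[0%R, pi%R]) \int[leb]_(ph in `[0%R, (2 * pi)%R])
      (g (sph th ph) * (sin th)%:E))%E.

Definition alpha (m m1 : R) : R := m1 / (m + m1).
Definition beta (eps : R) : R := (1 - eps) / 2.
Definition gam (m m1 eps : R) : R :=
  alpha m m1 * (1 - beta eps) / (1 - 2 * beta eps).
Definition gambar (m m1 eps : R) : R :=
  (1 - alpha m m1) * (1 - beta eps) / (1 - 2 * beta eps).
Definition th_sharp (m m1 eps th1 : R) : R :=
  (1 - alpha m m1) * (1 - beta eps) / (1 - alpha m m1 * (1 - beta eps)) * th1.

Definition Maxw (mass th : R) (u : V) (v : V) : R :=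
  (mass / (2 * pi * th)) `^ (3 / 2) * expR (- (mass * nrm2 (vsub v u)) / (2 * th)).
Definition M1 (m1 th1 : R) (u1 : V) : V -> R := Maxw m1 th1 u1.
Definition Mhash (m m1 eps th1 : R) (u1 : V) : V -> R :=
  Maxw m (th_sharp m m1 eps th1) u1.

Definition vstar (m m1 eps : R) (v w n : V) : V :=
  vsub v (vscale (2 * gam m m1 eps * dot (vsub v w) n) n).
Definition wstar (m m1 eps : R) (v w n : V) : V :=
  vadd w (vscale (2 * gambar m m1 eps * dot (vsub v w) n) n).

Definition sigma (m1 th1 : R) (u1 : V) (v : V) : R :=
  fine (\int[leb3]_w sphere_int
          (fun n => (`|dot (vsub v w) n| * M1 m1 th1 u1 w)%:E))%E.
Definition Qplus (m m1 eps th1 : R) (u1 : V) (f : V -> R) (v : V) : R :=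
  eps ^-2 * fine (\int[leb3]_w sphere_int
     (fun n => (`|dot (vsub v w) n| * f (vstar m m1 eps v w n)
                 * M1 m1 th1 u1 (wstar m m1 eps v w n))%:E))%E.

(** The space Y = L^1(R^3, dv); elements are represented by functions,
    all statements being up to leb3-a.e. equality. *)
Definition L1 (f : V -> R) : Prop := leb3.-integrable setT (EFin \o f).
Definition norm1 (f : V -> R) : \bar R := (\int[leb3]_x (`|f x|)%:E)%E.
Definition ae_eq (f g : V -> R) : Prop := {ae leb3, forall x, f x = g x}.
Definition ae_le (f g : V -> R) : Prop := {ae leb3, forall x, f x <= g x}.

Definition C0_semigroup (Z : R -> (V -> R) -> (V -> R)) : Prop :=
  [/\ (forall t f, 0 <= t -> L1 f -> L1 (Z t f)),
      (forall t f g, 0 <= t -> L1 f -> L1 g -> ae_eq f g -> ae_eq (Z t f) (Z t g)),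
      (forall t a b f g, 0 <= t -> L1 f -> L1 g ->
         ae_eq (Z t (fun v => a * f v + b * g v)) (fun v => a * Z t f v + b * Z t g v)),
      (forall t, 0 <= t -> exists c : R, forall f, L1 f ->
         (norm1 (Z t f) <= c%:E * norm1 f)%E) &
      [/\ (forall f, L1 f -> ae_eq (Z 0 f) f),
          (forall s t f, 0 <= s -> 0 <= t -> L1 f -> ae_eq (Z (s + t) f) (Z s (Z t f))) &
          (forall f, L1 f ->
             (fun t => norm1 (fun v => Z t f v - f v)) @ 0^'+ --> 0%E)]].

Definition positive_sg (Z : R -> (V -> R) -> (V -> R)) : Prop :=
  forall t f, 0 <= t -> L1 f -> ae_le (fun=> 0) f -> ae_le (fun=> 0) (Z t f).

Definition contraction_sg (Z : R -> (V -> R) -> (V -> R)) : Prop :=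
  forall t f, 0 <= t -> L1 f -> (norm1 (Z t f) <= norm1 f)%E.

Definition generator_at (Z : R -> (V -> R) -> (V -> R)) (f g : V -> R) : Prop :=
  [/\ L1 f, L1 g &
      (fun t => norm1 (fun v => (Z t f v - f v) / t - g v)) @ 0^'+ --> 0%E].

Definition gen_extends_LBE (m m1 eps th1 : R) (u1 : V)
    (Z : R -> (V -> R) -> (V -> R)) : Prop :=
  forall f, L1 f -> L1 (fun v => sigma m1 th1 u1 v * f v) ->
    generator_at Z f (fun v => - (sigma m1 th1 u1 v * f v) + Qplus m m1 eps th1 u1 f v).

Definition admissible_sg m m1 eps th1 u1 (Z : R -> (V -> R) -> (V -> R)) : Prop :=
  [/\ C0_semigroup Z, positive_sg Z, contraction_sg Z & gen_extends_LBE m m1 eps th1 u1 Z].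

Definition minimal_LBE_semigroup m m1 eps th1 u1 (Z : R -> (V -> R) -> (V -> R)) : Prop :=
  admissible_sg m m1 eps th1 u1 Z /\
  forall S, admissible_sg m m1 eps th1 u1 S ->
    forall t f, 0 <= t -> L1 f -> ae_le (fun=> 0) f -> ae_le (Z t f) (S t f).

(** Information I(f|g) = int (f ln f - f ln g) dv, with 0 ln 0 = 0 and
    x ln 0 = -oo for x > 0. *)
Definition info_density (x y : R) : \bar R :=
  if x == 0 then 0%E else if y == 0 then +oo%E else (x * ln x - x * ln y)%:E.
Definition info (f g : V -> R) : \bar R :=
  (\int[leb3]_v info_density (f v) (g v))%E.

End Defs.

(* Main.v *)
From HB Require Import structures.
Require Import Defs.
From mathcomp Require Import all_boot all_order all_algebra.
From mathcomp Require Import all_classical all_reals all_analysis.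
From mathcomp Require Import measurable_realfun ring lra.
Import Order.TTheory GRing.Theory Num.Theory.
Local Open Scope classical_set_scope.
Local Open Scope ring_scope.
Set Implicit Arguments. Unset Strict Implicit. Unset Printing Implicit Defensive.

(** The Maxwellian M is a fixed point of the semigroup: for fixed v and n, the
substitution w = w' + (1 - eps) ((v - w') . n) n, whose Jacobian is eps, scales
the normal relative velocity by eps and turns M(v_star) M1(w_star) into
M(v) M1(w'), so the factor eps^-2 is compensated and Q^+ M = sigma M pointwise.
As sigma grows at most quadratically, sigma M is integrable, so M lies in the
domain of the generator and is annihilated by it; hence Z(t) M = M for every t.

A positive linear contraction P of L^1 fixing M decreases the information. With
phi(x) = x ln x - x + 1 >= 0 one has
M phi(f / M) = sup_y (ln y f + (1 - y) M), so P (M phi(f / M)) dominates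
M phi(P f / M) almost everywhere; integrating gives the claim because P increases
neither the integral of M phi(f / M) nor that of f. *)

(** * Decrease of the information under a positive contraction *)

Section integrals.
Context d (T : measurableType d) (R : realType) (mu : {measure set T -> \bar R}).

Lemma integrable_lincomb (a b : R) (f g : T -> R) :
  mu.-integrable setT (EFin \o f) -> mu.-integrable setT (EFin \o g) ->
  mu.-integrable setT (EFin \o (fun x => a * f x + b * g x)).
Proof.
move=> fi gi.
have := integrableD measurableT (integrableZl measurableT a fi)
                                (integrableZl measurableT b gi).
by apply: eq_integrable => // x _; rewrite /= EFinD !EFinM.
Qed.

Lemma integral_lincomb (a b : R) (f g : T -> R) :
  mu.-integrable setT (EFin \o f) -> mu.-integrable setT (EFin \o g) ->
  (\int[mu]_x (a * f x + b * g x)%:E =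
   a%:E * \int[mu]_x (f x)%:E + b%:E * \int[mu]_x (g x)%:E)%E.
Proof.
move=> fi gi.
rewrite -(integralZl measurableT fi) -(integralZl measurableT gi).
by rewrite -integralD//; exact: integrableZl.
Qed.

(** The negative part of [h] is at most [|k|], hence has finite integral; an integral of [h] below
    [+oo] then leaves no room for an infinite positive part. *)
Lemma integrable_of_lb (k h : T -> R) :
  measurable_fun setT h -> mu.-integrable setT (EFin \o k) ->
  {ae mu, forall x, k x <= h x} -> (\int[mu]_x (h x)%:E < +oo)%E ->
  mu.-integrable setT (EFin \o h).
Proof.
move=> mh ki kh hoo.
have mh' : @measurable_fun _ _ T (\bar R) setT (EFin \o h) by exact/measurable_EFinP.
have neg : (\int[mu]_x ((EFin \o h)^\- x) < +oo)%E.
  apply: (le_lt_trans _ (integrableP _ _ _ ki).2).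
  apply: ae_ge0_le_integral => //.
  - exact: measurable_funeneg.
  - by apply: measurableT_comp => //; case/integrableP: ki.
  - apply: filterS kh => x kx _ /=.
    rewrite funenegE /= -EFin_max lee_fin.
    by rewrite ge_max normr_ge0 andbT; move: (ler_norm (- k x)); rewrite normrN; lra.
have pos : (\int[mu]_x ((EFin \o h)^\+ x) < +oo)%E.
  move: hoo neg; rewrite integralE.
  have : (0 <= \int[mu]_x (EFin \o h)^\+ x)%E by apply: integral_ge0 => x _.
  have : (0 <= \int[mu]_x (EFin \o h)^\- x)%E by apply: integral_ge0 => x _.
  by case: integral => [r||] //; case: integral => [s||] //; rewrite ?ltry.
apply/integrableP; split => //.
rewrite (_ : (fun x => _) = ((EFin \o h)^\+ \+ (EFin \o h)^\-)%E); last first.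
  by rewrite -fune_abse.
rewrite ge0_integralD//; first exact: lte_add_pinfty.
- exact: measurable_funepos.
- exact: measurable_funeneg.
Qed.

(** Positive and negative parts are compared separately, so the bound also applies to the entropy
    density of [P f], whose integrability is not established. *)
Lemma ae_le_integral (f g : T -> R) :
  measurable_fun setT f -> measurable_fun setT g ->
  {ae mu, forall x, f x <= g x} ->
  (\int[mu]_x (f x)%:E <= \int[mu]_x (g x)%:E)%E.
Proof.
move=> /measurable_EFinP mf /measurable_EFinP mg fg.
rewrite integralE [leRHS]integralE; apply: leeB.
- apply: ae_ge0_le_integral => //; [exact: measurable_funepos..|].
  apply: filterS fg => x fgx _.
  by rewrite !funeposE /= -!EFin_max lee_fin ge_max !le_max fgx lexx orbT.
- apply: ae_ge0_le_integral => //; [exact: measurable_funeneg..|].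
  apply: filterS fg => x fgx _.
  by rewrite !funenegE /= -!EFin_max lee_fin ge_max !le_max lerN2 fgx lexx orbT.
Qed.

End integrals.

(** * Tangent lines of the entropy function *)

Section entropy.
Context (R : realType).
Implicit Types a b c y : R.

(** For [b > 0] this is [b * phi (a / b)] with [phi x = x ln x - x + 1], the Bregman divergence of
    [x ln x]. *)
Definition bregman a b := a * ln a - a * ln b - a + b.

(** The left side is [b] times the tangent line of the convex function [phi] at [y], evaluated at
    [a / b]. *)
Lemma bregman_ge_tangent a b y : 0 <= a -> 0 < b -> 0 < y ->
  ln y * a + (1 - y) * b <= bregman a b.
Proof.
rewrite /bregman le_eqVlt => /predU1P[<-|a0] b0 y0; first by nra.
(* The bound [1 + t <= expR t] at [t = ln (y * b / a)], to be multiplied by [a]. *)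
have := @expR_ge1Dx R (ln y - ln a + ln b).
rewrite expRD expRB !lnK ?posrE// => h.
have : a * (1 + (ln y - ln a + ln b)) <= y * b.
  have -> : y * b = a * (y / a * b) by field; rewrite gt_eqF.
  by rewrite ler_pM2l.
lra.
Qed.

(** The supremum over tangent lines is reached at [y = a / b], and rational points approach it.
    Restricting to rationals leaves countably many conditions, which can be imposed almost
    everywhere at once. *)
Lemma bregman_le a b c : 0 <= a -> 0 < b ->
  (forall q : rat, 0 < q -> ln (ratr q) * a + (1 - ratr q) * b <= c) ->
  bregman a b <= c.
Proof.
move=> a0 b0 H; apply/ler_addgt0Pr => e e0.
pose y0 := a / b.
have y00 : 0 <= y0 by rewrite divr_ge0// ltW.
(* Choosing [q] above [y0] keeps it positive even when [a = 0] and makes [ln q * a] at least its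
   value at the contact point; the only loss is in [q * b], which exceeds [a] by at most [e]. *)
have [q] : exists q, ratr q \in `]y0, y0 + e / b[.
  by apply: rat_in_itvoo; rewrite ltrDl divr_gt0.
rewrite in_itv/= => /andP[yq qy].
have q0 : (0 : R) < ratr q by exact: le_lt_trans yq.
have := H q; rewrite -(ltr0q R) => /(_ q0).
have ab : a = y0 * b by rewrite /y0; field; rewrite gt_eqF.
have : ratr q * b <= a + e.
  have -> : a + e = (y0 + e / b) * b by rewrite /y0; field; rewrite gt_eqF.
  by rewrite ler_pM2r// ltW.
have : a * (ln a - ln b) <= ln (ratr q) * a.
  move: a0; rewrite le_eqVlt => /predU1P[<-|a0]; first by rewrite !(mul0r,mulr0).
  rewrite mulrC ler_pM2r// -ln_div ?posrE// ler_ln ?posrE//; last exact: divr_gt0.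
  exact: ltW.
rewrite /bregman; lra.
Qed.

End entropy.

(** * Positive contractions of L^1 fixing a positive function *)

Section positive_contraction.
Context d (T : measurableType d) (R : realType) (mu : {measure set T -> \bar R}).
Local Notation int f := (mu.-integrable setT (EFin \o f)).
Variables (P : (T -> R) -> (T -> R)) (M : T -> R).
Hypothesis PL1 : forall f, int f -> int (P f).
Hypothesis Plin : forall a b f g, int f -> int g ->
  {ae mu, forall x, P (fun x => a * f x + b * g x) x = a * P f x + b * P g x}.
Hypothesis Ppos : forall f, int f -> {ae mu, forall x, 0 <= f x} ->
  {ae mu, forall x, 0 <= P f x}.
Hypothesis Pcontr : forall f, int f ->
  (\int[mu]_x `|P f x|%:E <= \int[mu]_x `|f x|%:E)%E.
Hypothesis Mint : int M.
Hypothesis M_gt0 : forall x, 0 < M x.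
Hypothesis PM : {ae mu, forall x, P M x = M x}.

(** On nonnegative functions the integral is the L^1 norm, and [P] preserves nonnegativity. *)
Lemma positive_integral_le f : int f -> {ae mu, forall x, 0 <= f x} ->
  (\int[mu]_x (P f x)%:E <= \int[mu]_x (f x)%:E)%E.
Proof.
move=> fi f0.
have mabs g : int g -> @measurable_fun _ _ T (\bar R) setT (fun x => `|g x|%:E).
  by move=> /integrableP[/measurable_EFinP mg _]; apply/measurable_EFinP; exact: measurableT_comp.
have e g : int g -> {ae mu, forall x, 0 <= g x} ->
    (\int[mu]_x (g x)%:E = \int[mu]_x `|g x|%:E)%E.
  move=> gi g0; apply: ae_eq_integral => //.
  - by case/integrableP: gi.
  - exact: mabs.
  - by apply: filterS g0 => x g0 _; rewrite ger0_norm.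
by rewrite (e _ fi f0) (e _ (PL1 fi) (Ppos fi f0)); exact: Pcontr.
Qed.

Lemma positive_mono f g : int f -> int g -> {ae mu, forall x, f x <= g x} ->
  {ae mu, forall x, P f x <= P g x}.
Proof.
move=> fi gi fg.
have := Ppos (integrable_lincomb 1 (-1) gi fi).
have /[swap]/[apply] : {ae mu, forall x, 0 <= 1 * g x + -1 * f x}.
  by apply: filterS fg => x; lra.
apply: filterS2 (Plin 1 (-1) gi fi) => x ->; lra.
Qed.

(* [bregman (f x) (M x)] is the supremum over y of the functions
   [ln y * f x + (1 - y) * M x]; P maps each of them to the same combination of
   [P f] and [M], so countably many y give the pointwise (Jensen) inequality. *)
Lemma bregman_jensen f g : int f -> {ae mu, forall x, 0 <= f x} -> int g ->
  {ae mu, forall x, bregman (f x) (M x) <= g x} ->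
  {ae mu, forall x, bregman (P f x) (M x) <= P g x}.
Proof.
move=> fi f0 gi fg.
have H (q : rat) : {ae mu, forall x, 0 < q ->
    ln (ratr q) * P f x + (1 - ratr q) * M x <= P g x}.
  have [q0|q0] := ltP 0 q; last by apply: aeW => x.
  have Q0 : (0 : R) < ratr q by rewrite ltr0q.
  have := positive_mono (integrable_lincomb (ln (ratr q)) (1 - ratr q) fi Mint) gi.
  have /[swap]/[apply] : {ae mu, forall x,
      ln (ratr q) * f x + (1 - ratr q) * M x <= g x}.
    apply: filterS2 f0 fg => x fx; apply: le_trans.
    exact: bregman_ge_tangent.
  move=> h; have := Plin (ln (ratr q)) (1 - ratr q) fi Mint.
  by apply: filterS3 PM h => x -> h <-.
(* Enumerating the rationals by [unpickle] merges the exceptional null sets of all [q] into one. *)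
have := Ppos fi f0; have /ae_foralln : forall n, {ae mu, forall x, forall q : rat,
    unpickle n = Some q -> 0 < q ->
    ln (ratr q) * P f x + (1 - ratr q) * M x <= P g x}.
  move=> n; case: (unpickle n) => [q|]; last by apply: aeW => x.
  by apply: filterS (H q) => x hx _ [<-].
apply: filterS2 => x hx pfx; apply: bregman_le => // q q0.
exact: (hx (pickle q) q (pickleK q)).
Qed.

(** The entropy density is [bregman (f x) (M x) + f x - M x]. The Bregman part decreases by
    [bregman_jensen], the integral of [f] does not increase, and that of [M] appears unchanged on
    both sides. *)
Lemma relative_entropy_le f : int f -> {ae mu, forall x, 0 <= f x} ->
  (\int[mu]_x (P f x * ln (P f x) - P f x * ln (M x))%:E <=
   \int[mu]_x (f x * ln (f x) - f x * ln (M x))%:E)%E.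
Proof.
move=> fi f0; set h := fun x => f x * ln (f x) - f x * ln (M x).
set k := fun x => P f x * ln (P f x) - P f x * ln (M x).
have mEnt u : int u ->
    measurable_fun setT (fun x => u x * ln (u x) - u x * ln (M x)).
  move=> ui.
  have mu' : measurable_fun setT u by apply/measurable_EFinP; case/integrableP: ui.
  have mM : measurable_fun setT M by apply/measurable_EFinP; case/integrableP: Mint.
  by apply: measurable_funB; apply: measurable_funM => //;
    apply: measurableT_comp => //; exact: measurable_ln.
(* The tangent at [y = 1] says that [bregman] is nonnegative, which bounds the density below by the
   integrable [u - M]. *)
have lb u : int u -> {ae mu, forall x, 0 <= u x} ->
    {ae mu, forall x, 1 * u x + -1 * M x <= u x * ln (u x) - u x * ln (M x)}.
  move=> ui; apply: filterS => x u0.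
  by have := bregman_ge_tangent u0 (M_gt0 x) ltr01; rewrite /bregman ln1; lra.
have := leey (\int[mu]_x (h x)%:E)%E; rewrite le_eqVlt => /predU1P[->|hoo].
  exact: leey.
have hi : int h.
  apply: (integrable_of_lb (mEnt _ fi)) hoo; last exact: lb.
  exact: integrable_lincomb.
pose fM x := 1 * M x + -1 * f x.
have fMi : int fM by exact: integrable_lincomb.
(* [g] equals [bregman (f x) (M x)], written as a linear combination so that the linearity lemmas
   apply to it. *)
pose g x := 1 * h x + 1 * fM x.
have gi : int g by exact: integrable_lincomb.
have g0 : {ae mu, forall x, 0 <= g x}.
  by apply: filterS (lb f fi f0) => x; rewrite /g /fM /h; lra.
have Pg : {ae mu, forall x, bregman (P f x) (M x) <= P g x}.
  apply: bregman_jensen => //; apply: aeW => x.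
  by rewrite /bregman /g /fM /h; lra.
pose Pfg x := 1 * P g x + 1 * (1 * P f x + -1 * M x).
have PfMi : int (fun x => 1 * P f x + -1 * M x).
  exact: integrable_lincomb (PL1 fi) Mint.
have Pfgi : int Pfg by exact: integrable_lincomb (PL1 gi) PfMi.
have kub : {ae mu, forall x, k x <= Pfg x}.
  by apply: filterS Pg => x; rewrite /bregman /k /Pfg; lra.
have mPfg : measurable_fun setT Pfg by apply/measurable_EFinP; case/integrableP: Pfgi.
apply: (le_trans (ae_le_integral (mEnt _ (PL1 fi)) mPfg kub)).
rewrite /Pfg (integral_lincomb _ _ (PL1 gi) PfMi).
rewrite (integral_lincomb _ _ (PL1 fi) Mint) !mul1e.
have := positive_integral_le fi f0.
have := positive_integral_le gi g0.
rewrite [in X in (_ <= X)%E -> _ -> _](integral_lincomb _ _ hi fMi).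
rewrite [in X in (_ <= X)%E -> _ -> _](integral_lincomb _ _ Mint fi) !mul1e.
(* All five integrals are finite, so the claim becomes a linear inequality between reals. *)
have := integrable_fin_num measurableT (PL1 gi).
have := integrable_fin_num measurableT (PL1 fi).
have := integrable_fin_num measurableT fi.
have := integrable_fin_num measurableT hi.
have := integrable_fin_num measurableT Mint.
rewrite /comp.
case: integral => [r1 _||]//; case: integral => [r2 _||]//.
case: integral => [r3 _||]//; case: integral => [r4 _||]//.
case: integral => [r5 _||]//.
rewrite -?(EFinM,EFinD) !lee_fin; lra.
Qed.

End positive_contraction.

(** * Change of variables in R^3 *)

Section sigma_finite_product.
Context d1 d2 (T1 : measurableType d1) (T2 : measurableType d2) (R : realType).
Context (m1 : {sigma_finite_measure set T1 -> \bar R}).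
Context (m2 : {sigma_finite_measure set T2 -> \bar R}).

(** A named copy of the product measure that can carry a sigma-finite structure, so that Tonelli's
    theorem can be iterated on R^3. *)
Definition sf_prod : set (T1 * T2) -> \bar R := (m1 \x m2)%E.

HB.instance Definition _ := Measure.on sf_prod.

Let sf_prod_sigma_finite : sigma_finite setT sf_prod.
Proof.
have /sigma_finiteP[F [FT Fnd Ffin]] := sigma_finiteT m1.
have /sigma_finiteP[G [GT Gnd Gfin]] := sigma_finiteT m2.
(* Both exhausting sequences are nondecreasing, so a point of [F i] times [G j] lies in the
   rectangle of index [maxn i j]. *)
exists (fun n => F n `*` G n) => [|n].
  apply/seteqP; split => // -[x y] _.
  have [i _ Fx] : (\bigcup_i F i) x by rewrite -FT.
  have [j _ Gy] : (\bigcup_i G i) y by rewrite -GT.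
  exists (maxn i j) => //; split.
    by move/subsetPset: (Fnd _ _ (leq_maxl i j)); exact.
  by move/subsetPset: (Gnd _ _ (leq_maxr i j)); exact.
have [mF Fn] := Ffin n; have [mG Gn] := Gfin n.
split; first exact: measurableX.
by rewrite /sf_prod product_measure1E// lte_mul_pinfty// ge0_fin_numE.
Qed.

HB.instance Definition _ := Measure_isSigmaFinite.Build _ _ _ sf_prod
  sf_prod_sigma_finite.

End sigma_finite_product.

Section leb3_sigma_finite.
Variable R : realType.
Definition leb2_sf : {sigma_finite_measure set _ -> \bar R} :=
  sf_prod (@lebesgue_measure R) (@lebesgue_measure R).
Definition leb3_sf : {sigma_finite_measure set _ -> \bar R} :=
  sf_prod leb2_sf (@lebesgue_measure R).
(** The two measures are convertible; rewriting with this equation makes the sigma-finite structure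
    visible to integration lemmas. *)
Lemma integral_leb3E (f : V R -> \bar R) :
  (\int[@leb3 R]_x f x = \int[leb3_sf]_x f x)%E.
Proof. by []. Qed.
End leb3_sigma_finite.

(** * Consequences of Tonelli's theorem *)

Section tonelli_slices.
Context d1 d2 (T1 : measurableType d1) (T2 : measurableType d2) (R : realType).
Context (m1 : {sigma_finite_measure set T1 -> \bar R}).
Context (m2 : {sigma_finite_measure set T2 -> \bar R}).
Local Open Scope ereal_scope.

(** Used for shears of R^3 that leave the last coordinate fixed. *)
Lemma integral_prod_slices (c : R) (h g : T1 * T2 -> \bar R) : (0 <= c)%R ->
  measurable_fun setT h -> measurable_fun setT g ->
  (forall p, 0 <= h p) -> (forall p, 0 <= g p) ->
  (forall y, \int[m1]_x h (x, y) = c%:E * \int[m1]_x g (x, y)) ->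
  \int[m1 \x m2]_p h p = c%:E * \int[m1 \x m2]_p g p.
Proof.
move=> c0 mh mg h0 g0 hg.
rewrite (fubini_tonelli2 h)// (fubini_tonelli2 g)//.
rewrite -ge0_integralZl//.
- by apply: eq_integral => y _; exact: hg.
- exact: measurable_fun_fubini_tonelli_G.
- by move=> x _; exact: integral_ge0.
Qed.

End tonelli_slices.

Section tonelli_product.
Context d1 d2 (T1 : measurableType d1) (T2 : measurableType d2) (R : realType).
Context (m1 : {sigma_finite_measure set T1 -> \bar R}).
Context (m2 : {sigma_finite_measure set T2 -> \bar R}).
Local Open Scope ereal_scope.

Lemma integral_prod_mul_lty (f : T1 -> R) (g : T2 -> R) :
  measurable_fun setT f -> measurable_fun setT g ->
  (forall x, 0 <= f x)%R -> (forall y, 0 <= g y)%R ->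
  \int[m1]_x (f x)%:E < +oo -> \int[m2]_y (g y)%:E < +oo ->
  \int[m1 \x m2]_p (f p.1 * g p.2)%:E < +oo.
Proof.
move=> mf mg f0 g0 foo goo; rewrite fubini_tonelli1; last 2 first.
- by apply/measurable_EFinP; apply: measurable_funM; exact: measurableT_comp.
- by move=> p; rewrite lee_fin mulr_ge0.
rewrite (_ : integral _ _ _ = \int[m1]_x ((f x)%:E * \int[m2]_y (g y)%:E)).
  rewrite ge0_integralZr//.
  - apply: lte_mul_pinfty => //; first by apply: integral_ge0 => x _; rewrite lee_fin.
    by rewrite ge0_fin_numE// integral_ge0// => x _; rewrite lee_fin.
  - exact/measurable_EFinP.
  - by move=> x _; rewrite lee_fin.
  - by apply: integral_ge0 => x _; rewrite lee_fin.
apply: eq_integral => x _; rewrite /fubini_F /=.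
under eq_integral do rewrite EFinM.
rewrite ge0_integralZl//.
- exact/measurable_EFinP.
- by move=> y _; rewrite lee_fin.
- by rewrite lee_fin.
Qed.

End tonelli_product.

(** * Affine maps of the line and planar shears *)

Section affine_change_of_variables.
Context (R : realType).
Local Open Scope ereal_scope.

(** Lebesgue measure is [a] times its pushforward under [x -> a * x + b], because the two measures
    agree on half-open intervals. *)
Lemma integral_affine (a b : R) (f : R -> \bar R) : (0 < a)%R ->
  measurable_fun setT f -> (forall x, 0 <= f x) ->
  \int[leb (R:=R)]_x f (a * x + b)%R = a^-1%:E * \int[leb (R:=R)]_x f x.
Proof.
move=> a0 mf f0.
have a0' : (0 <= a)%R by exact: ltW.
pose phi (x : measurableTypeR R) : measurableTypeR R := (a * x + b)%R.
have mphi : measurable_fun setT phi.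
  by apply: measurable_funD => //; apply: measurable_funM.
pose nu := mscale (NngNum a0') (pushforward (@lebesgue_measure R) phi).
have nuE A : measurable A -> lebesgue_measure A = nu mphi A.
  apply: lebesgue_measure_unique => _ [[x y] _ <-] /=.
  rewrite /nu /mscale /pushforward.
  rewrite [X in _ = _ * X](_ : _ =
      lebesgue_measure `]((x - b) / a)%R, ((y - b) / a)%R]%classic); last first.
    congr (lebesgue_measure _); apply/seteqP; split => z; rewrite /= !in_itv/= /phi;
    by rewrite ltr_pdivrMr// ler_pdivlMr// ltrBlDr lerBrDr mulrC.
  rewrite !lebesgue_measure_itv/= !lte_fin ltr_pM2r ?invr_gt0// ltrD2r.
  case: ifPn => _; rewrite ?mule0// -!EFinD -EFinM; congr EFin.
  by field; rewrite gt_eqF.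
rewrite [in RHS](eq_measure_integral (nu mphi)); last by move=> A mA _; exact: nuE.
rewrite /nu ge0_integral_mscale// (ge0_integral_pushforward mphi)//.
rewrite muleA -EFinM mulVf ?gt_eqF// mul1e.
by rewrite preimage_setT.
Qed.

Context d (T : measurableType d) (mu : {sigma_finite_measure set T -> \bar R}).

(** Once the first coordinate is fixed the map is affine in the second, so Tonelli reduces the claim
    to dimension one. *)
Lemma integral_shear_snd (a : R) (phi : T -> R) (g : T * R -> \bar R) :
  (0 < a)%R -> measurable_fun setT phi -> measurable_fun setT g ->
  (forall p, 0 <= g p) ->
  \int[mu \x leb (R:=R)]_p g (p.1, a * p.2 + phi p.1)%R =
  a^-1%:E * \int[mu \x leb (R:=R)]_p g p.
Proof.
move=> a0 mphi mg g0.
have mh : measurable_fun setT (fun p : T * R => g (p.1, a * p.2 + phi p.1)%R).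
  apply: measurableT_comp => //; apply: measurable_fun_pair => //.
  apply: measurable_funD; last exact: measurableT_comp.
  exact: measurable_funM.
rewrite fubini_tonelli1// [in RHS]fubini_tonelli1//.
rewrite -ge0_integralZl//; last 3 first.
- exact: measurable_fun_fubini_tonelli_F.
- by move=> x _; exact: integral_ge0.
- by rewrite lee_fin invr_ge0 ltW.
apply: eq_integral => x _; rewrite /fubini_F /=.
rewrite (@integral_affine a (phi x) (fun y => g (x, y)))//.
exact: measurable_fun_pair2.
Qed.

Lemma integral_shear_fst (a : R) (phi : T -> R) (g : R * T -> \bar R) :
  (0 < a)%R -> measurable_fun setT phi -> measurable_fun setT g ->
  (forall p, 0 <= g p) ->
  \int[leb (R:=R) \x mu]_p g (a * p.1 + phi p.2, p.2)%R =
  a^-1%:E * \int[leb (R:=R) \x mu]_p g p.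
Proof.
move=> a0 mphi mg g0.
have mh : measurable_fun setT (fun p : R * T => g (a * p.1 + phi p.2, p.2)%R).
  apply: measurableT_comp => //; apply: measurable_fun_pair => //.
  apply: measurable_funD; last exact: measurableT_comp.
  exact: measurable_funM.
rewrite fubini_tonelli2// [in RHS]fubini_tonelli2//.
rewrite -ge0_integralZl//; last 3 first.
- exact: measurable_fun_fubini_tonelli_G.
- by move=> x _; exact: integral_ge0.
- by rewrite lee_fin invr_ge0 ltW.
apply: eq_integral => x _; rewrite /fubini_G /=.
rewrite (@integral_affine a (phi x) (fun y => g (y, x)))//.
exact: measurable_fun_pair1.
Qed.

End affine_change_of_variables.

(** * Rank-one perturbations of the identity in R^3 *)

Section rank_one_change_of_variables.
Context (R : realType).
Local Open Scope ereal_scope.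

Lemma leb3_shear_x (a : R) (phi : R * R -> R) (g : V R -> \bar R) :
  (0 < a)%R -> measurable_fun setT phi -> measurable_fun setT g ->
  (forall p, 0 <= g p) ->
  \int[@leb3 R]_w g (a * w.1.1 + phi (w.1.2, w.2), w.1.2, w.2)%R =
  a^-1%:E * \int[@leb3 R]_w g w.
Proof.
move=> a0 mphi mg g0.
have mh : measurable_fun setT
    (fun w : R * R * R => g (a * w.1.1 + phi (w.1.2, w.2), w.1.2, w.2)%R).
  apply: measurableT_comp => //; apply: measurable_fun_pair => //.
  apply: measurable_fun_pair; last exact: measurableT_comp.
  apply: measurable_funD; last first.
    apply: measurableT_comp => //; apply: measurable_fun_pair => //.
    exact: measurableT_comp.
  by apply: measurable_funM => //; exact: measurableT_comp.
have a0' : (0 <= a^-1)%R by rewrite invr_ge0 ltW.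
apply: (integral_prod_slices (m1 := leb2_sf R) (@lebesgue_measure R)) => //.
move=> z /=.
apply: (@integral_shear_fst R _ _ (@leb R) a (fun y => phi (y, z)) (fun p => g (p, z))) => //.
  exact: measurable_fun_pair1.
exact: measurable_fun_pair1.
Qed.

Lemma leb3_shear_y (a : R) (phi : R * R -> R) (g : V R -> \bar R) :
  (0 < a)%R -> measurable_fun setT phi -> measurable_fun setT g ->
  (forall p, 0 <= g p) ->
  \int[@leb3 R]_w g (w.1.1, a * w.1.2 + phi (w.1.1, w.2), w.2)%R =
  a^-1%:E * \int[@leb3 R]_w g w.
Proof.
move=> a0 mphi mg g0.
have mh : measurable_fun setT
    (fun w : R * R * R => g (w.1.1, a * w.1.2 + phi (w.1.1, w.2), w.2)%R).
  apply: measurableT_comp => //; apply: measurable_fun_pair => //.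
  apply: measurable_fun_pair; first exact: measurableT_comp.
  apply: measurable_funD; last first.
    apply: measurableT_comp => //; apply: measurable_fun_pair => //.
    exact: measurableT_comp.
  by apply: measurable_funM => //; exact: measurableT_comp.
have a0' : (0 <= a^-1)%R by rewrite invr_ge0 ltW.
apply: (integral_prod_slices (m1 := leb2_sf R) (@lebesgue_measure R)) => //.
move=> z /=.
apply: (@integral_shear_snd R _ _ (@leb R) a (fun y => phi (y, z)) (fun p => g (p, z))) => //.
  exact: measurable_fun_pair1.
exact: measurable_fun_pair1.
Qed.

Lemma leb3_shear_z (a : R) (phi : R * R -> R) (g : V R -> \bar R) :
  (0 < a)%R -> measurable_fun setT phi -> measurable_fun setT g ->
  (forall p, 0 <= g p) ->
  \int[@leb3 R]_w g (w.1, a * w.2 + phi w.1)%R =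
  a^-1%:E * \int[@leb3 R]_w g w.
Proof. exact: (@integral_shear_snd R _ _ (leb2_sf R)). Qed.

(** For a unit vector [n], this moves [w] along [n] so that the component of [v - w] along [n] is
    multiplied by [1 - c]; the point [v] is fixed. *)
Definition shrink (c : R) (v n w : V R) : V R :=
  vadd w (vscale (c * dot (vsub v w) n) n).

(* The linear part of [shrink c v n] is [1 - c n n^T]; eliminating one
   coordinate at a time factors it into three shears whose diagonal entries are
   the ratios of its leading minors. *)
Lemma integral_shrink (c : R) (v n : V R) (g : V R -> \bar R) :
  (0 < c < 1)%R -> nrm2 n = 1%R -> measurable_fun setT g ->
  (forall p, 0 <= g p) ->
  \int[@leb3 R]_w g (shrink c v n w) = (1 - c)^-1%:E * \int[@leb3 R]_w g w.
Proof.
move=> /andP[c0 c1]; case: n v => [[n1 n2] n3] [[v1 v2] v3].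
rewrite /nrm2 /dot /= => n_1 mg g0.
(* [d1], [d2], [d3] are the leading principal minors of [1 - c n n^T], positive because [c < 1] and
   [|n| = 1]. *)
pose d1 : R := (1 - c * (n1 * n1))%R.
pose d2 : R := (1 - c * (n1 * n1 + n2 * n2))%R.
pose d3 : R := (1 - c * (n1 * n1 + n2 * n2 + n3 * n3))%R.
have d2_gt0 : (0 < d2)%R by rewrite /d2; have := sqr_ge0 n3; rewrite expr2; nra.
have d1_gt0 : (0 < d1)%R by rewrite /d1; have := sqr_ge0 n3; have := sqr_ge0 n2; rewrite !expr2; nra.
have d3E : d3 = (1 - c)%R by rewrite /d3 n_1 mulr1.
have d3_gt0 : (0 < d3)%R by rewrite d3E; lra.
rewrite -d3E.
have [d1N0 d2N0] : d1 != 0%R /\ d2 != 0%R by rewrite !gt_eqF.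
(* The offsets are centred at the fixed point [v]; [phi2] and [phi3] take the coordinates already
   transformed by the preceding shears, as in Gaussian elimination. *)
pose phi1 (p : R * R) : R :=
  (v1 - d1 * v1 - c * n1 * n2 * (p.1 - v2) - c * n1 * n3 * (p.2 - v3))%R.
pose phi2 (p : R * R) : R :=
  (v2 - d2 / d1 * v2 - c * n1 * n2 / d1 * (p.1 - v1)
   - c * n2 * n3 / d1 * (p.2 - v3))%R.
pose phi3 (p : R * R) : R :=
  (v3 - d3 / d2 * v3 - c * n1 * n3 / d2 * (p.1 - v1)
   - c * n2 * n3 / d2 * (p.2 - v2))%R.
have mphi (a b k e f : R) : measurable_fun setT
    (fun p : R * R => a - b * (p.1 - e) - k * (p.2 - f))%R.
  apply: measurable_funB; [apply: measurable_funB => //|];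
  by apply: measurable_funM => //; apply: measurable_funB.
have mphi1 : measurable_fun setT phi1.
  exact: (mphi _ (c * n1 * n2) (c * n1 * n3) v2 v3)%R.
have mphi2 : measurable_fun setT phi2.
  exact: (mphi _ (c * n1 * n2 / d1) (c * n2 * n3 / d1) v1 v3)%R.
have mphi3 : measurable_fun setT phi3.
  exact: (mphi _ (c * n1 * n3 / d2) (c * n2 * n3 / d2) v1 v2)%R.
pose P1 (w : V R) : V R := (d1 * w.1.1 + phi1 (w.1.2, w.2), w.1.2, w.2)%R.
pose P2 (w : V R) : V R := (w.1.1, d2 / d1 * w.1.2 + phi2 (w.1.1, w.2), w.2)%R.
pose P3 (w : V R) : V R := (w.1, d3 / d2 * w.2 + phi3 w.1)%R.
have mP3 : measurable_fun setT P3.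
  apply: measurable_fun_pair => //; apply: measurable_funD.
    exact: measurable_funM.
  exact: measurableT_comp.
have mP2 : measurable_fun setT P2.
  apply: measurable_fun_pair => //; apply: measurable_fun_pair.
    exact: measurableT_comp.
  apply: measurable_funD.
    by apply: measurable_funM => //; exact: measurableT_comp.
  apply: measurableT_comp; first exact: mphi2.
  by apply: measurable_fun_pair => //; exact: measurableT_comp.
transitivity (\int[@leb3 R]_w (g \o P3 \o P2) (P1 w)).
  apply: eq_integral => -[[x y] z] _ /=; congr g.
  rewrite /shrink /P3 /P2 /P1 /phi1 /phi2 /phi3 /vadd /vscale /vec /vsub /dot /=.
  rewrite /vadd/=.
  congr (_, _, _).
  - by rewrite /d1; ring.
  - by move: d1N0; rewrite /d2 /d1 => ?; field.
  - by move: d1N0 d2N0; rewrite /d3 /d2 /d1 => ? ?; field; apply/andP.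
rewrite (leb3_shear_x d1_gt0 mphi1 (g := g \o P3 \o P2))//; last 2 first.
- by apply: measurableT_comp => //; exact: measurableT_comp.
- by move=> p; exact: g0.
rewrite (leb3_shear_y (divr_gt0 d2_gt0 d1_gt0) mphi2 (g := g \o P3))//; last 2 first.
- exact: measurableT_comp.
- by move=> p; exact: g0.
rewrite (leb3_shear_z (divr_gt0 d3_gt0 d2_gt0) mphi3)//.
(* The diagonal entries [d1], [d2 / d1], [d3 / d2] telescope to the determinant [d3]. *)
rewrite !muleA -!EFinM; congr (_%:E * _).
by field; rewrite d1N0 d2N0 gt_eqF.
Qed.

End rank_one_change_of_variables.

(** * Integration over the sphere *)

Section measurable_vectors.
Context (R : realType) d (T : measurableType d).
Implicit Types F G : T -> V R.

Lemma measurable_vec (f g h : T -> R) : measurable_fun setT f ->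
  measurable_fun setT g -> measurable_fun setT h ->
  measurable_fun setT (fun x => vec (f x) (g x) (h x) : R * R * R).
Proof. by move=> *; do 2![apply: measurable_fun_pair => //]. Qed.

Lemma measurable_coords F : measurable_fun setT (F : T -> R * R * R) ->
  [/\ measurable_fun setT (fun x => (F x).1.1),
      measurable_fun setT (fun x => (F x).1.2) &
      measurable_fun setT (fun x => (F x).2)].
Proof.
move=> mF; have mF1 : measurable_fun setT (fun x => (F x).1 : R * R).
  exact: (measurableT_comp measurable_fst mF).
split.
- exact: (measurableT_comp measurable_fst mF1).
- exact: (measurableT_comp measurable_snd mF1).
- exact: (measurableT_comp measurable_snd mF).
Qed.

Lemma measurable_vadd F G : measurable_fun setT (F : T -> R * R * R) ->
  measurable_fun setT (G : T -> R * R * R) ->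
  measurable_fun setT (fun x => vadd (F x) (G x) : R * R * R).
Proof.
move=> /measurable_coords[? ? ?] /measurable_coords[? ? ?].
by apply: measurable_vec; exact: measurable_funD.
Qed.

Lemma measurable_vscale (f : T -> R) F : measurable_fun setT f ->
  measurable_fun setT (F : T -> R * R * R) ->
  measurable_fun setT (fun x => vscale (f x) (F x) : R * R * R).
Proof.
move=> ? /measurable_coords[? ? ?].
by apply: measurable_vec; exact: measurable_funM.
Qed.

Lemma measurable_vsub F G : measurable_fun setT (F : T -> R * R * R) ->
  measurable_fun setT (G : T -> R * R * R) ->
  measurable_fun setT (fun x => vsub (F x) (G x) : R * R * R).
Proof. by move=> mF mG; apply: measurable_vadd => //; exact: measurable_vscale. Qed.

Lemma measurable_dot F G : measurable_fun setT (F : T -> R * R * R) ->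
  measurable_fun setT (G : T -> R * R * R) ->
  measurable_fun setT (fun x => dot (F x) (G x)).
Proof.
move=> /measurable_coords[? ? ?] /measurable_coords[? ? ?].
by do 2?[apply: measurable_funD]; exact: measurable_funM.
Qed.

Lemma measurable_Maxw (mass th : R) (u : V R) F :
  measurable_fun setT (F : T -> R * R * R) ->
  measurable_fun setT (fun x => Maxw mass th u (F x)).
Proof.
move=> mF; apply: measurable_funM => //.
apply: measurableT_comp => //.
apply: measurable_funM => //; apply: measurable_funN.
apply: measurable_funM => //; have mFu := measurable_vsub mF (measurable_cst u).
exact: measurable_dot.
Qed.

End measurable_vectors.

Section sphere.
Context (R : realType).
Local Open Scope ereal_scope.

Lemma nrm2_sph (th ph : R) : nrm2 (sph th ph) = 1%R.
Proof.
rewrite /nrm2 /dot /sph /vec /=.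
rewrite [LHS](_ : _ = ((cos ph ^+ 2 + sin ph ^+ 2) * sin th ^+ 2 + cos th ^+ 2)%R).
  by rewrite cos2Dsin2 mul1r addrC cos2Dsin2.
by ring.
Qed.

Lemma eq_sphere_int (f g : V R -> \bar R) :
  (forall n, nrm2 n = 1%R -> f n = g n) -> sphere_int f = sphere_int g.
Proof.
move=> fg; apply: eq_integral => th _; apply: eq_integral => ph _.
by rewrite fg// nrm2_sph.
Qed.

(** The density of the surface measure, extended by zero off the parameter rectangle: a sphere
    integral becomes one integral over the plane, to which Tonelli applies. *)
Definition sph_weight (a : R * R) : R :=
  (sin a.1 * \1_(`[0, pi]%classic : set R) a.1 *
   \1_(`[0, 2 * pi]%classic : set R) a.2)%R.

Lemma sph_weight_ge0 a : (0 <= sph_weight a)%R.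
Proof.
rewrite /sph_weight !indicE mulr_ge0//.
have [|_] := boolP (a.1 \in _); last by rewrite mulr0.
by rewrite mulr1 inE/= => /sin_ge0_pi.
Qed.

Lemma measurable_sph_weight : measurable_fun setT sph_weight.
Proof.
apply: measurable_funM; [apply: measurable_funM|].
- by apply: measurableT_comp => //; exact: continuous_measurable_fun (@continuous_sin R).
- by apply: measurableT_comp => //; exact: measurable_indic.
- by apply: measurableT_comp => //; exact: measurable_indic.
Qed.

Definition sph_pair (a : R * R) : R * R * R := sph a.1 a.2.

Lemma measurable_sph_pair : measurable_fun setT sph_pair.
Proof.
have ms := continuous_measurable_fun (@continuous_sin R).
have mc := continuous_measurable_fun (@continuous_cos R).
apply: measurable_vec; [apply: measurable_funM|apply: measurable_funM|];
by apply: measurableT_comp.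
Qed.

Lemma sphere_intE (g : V R -> \bar R) :
  measurable_fun setT (g : R * R * R -> \bar R) -> (forall n, 0 <= g n) ->
  sphere_int g = \int[leb2_sf R]_a (g (sph_pair a) * (sph_weight a)%:E).
Proof.
move=> mg g0; rewrite /leb2_sf fubini_tonelli1; last 2 first.
- apply: emeasurable_funM; first exact: (measurableT_comp mg measurable_sph_pair).
  by apply/measurable_EFinP; exact: measurable_sph_weight.
- by move=> a; rewrite mule_ge0// lee_fin sph_weight_ge0.
rewrite /sphere_int /leb [LHS]integral_mkcond; apply: eq_integral => th _.
rewrite patchE /fubini_F; case: ifPn => thD; last first.
  apply/esym/integral0_eq => ph _.
  by rewrite /sph_weight /= indicE (negbTE thD) mulr0 mul0r mule0.
rewrite [LHS]integral_mkcond; apply: eq_integral => ph _.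
rewrite patchE /sph_weight /= !indicE thD mulr1; case: ifPn => phE.
  by rewrite mulr1.
by rewrite mulr0 mule0.
Qed.

Lemma sphere_intZ (k : R) (g : V R -> \bar R) : (0 <= k)%R ->
  measurable_fun setT (g : R * R * R -> \bar R) -> (forall n, 0 <= g n) ->
  sphere_int (fun n => k%:E * g n) = k%:E * sphere_int g.
Proof.
move=> k0 mg g0; have k0' : 0 <= k%:E by rewrite lee_fin.
rewrite !sphere_intE//; last 2 first.
- exact: measurable_funeM.
- by move=> n; exact: mule_ge0.
rewrite -ge0_integralZl//.
- by apply: eq_integral => a _; rewrite muleA.
- apply: emeasurable_funM; first exact: (measurableT_comp mg measurable_sph_pair).
  by apply/measurable_EFinP; exact: measurable_sph_weight.
- by move=> a _; rewrite mule_ge0// lee_fin sph_weight_ge0.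
Qed.

Context d (T : measurableType d) (mu : {sigma_finite_measure set T -> \bar R}).
Variable G : T -> V R -> \bar R.
Hypothesis mG : measurable_fun setT (fun p : T * (R * R * R) => G p.1 p.2).
Hypothesis G0 : forall x n, 0 <= G x n.

Let H (p : T * (R * R)) := G p.1 (sph_pair p.2) * (sph_weight p.2)%:E.

Let mH : measurable_fun setT H.
Proof.
have mp : measurable_fun setT (fun p : T * (R * R) => (p.1, sph_pair p.2)).
  apply: measurable_fun_pair => //.
  exact: (measurableT_comp measurable_sph_pair).
apply: emeasurable_funM; first exact: (measurableT_comp mG mp).
by apply/measurable_EFinP; apply: measurableT_comp => //; exact: measurable_sph_weight.
Qed.

Let H0 p : 0 <= H p.
Proof. by rewrite mule_ge0// lee_fin sph_weight_ge0. Qed.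

Let sphere_intH x : sphere_int (G x) = fubini_F (leb2_sf R) H x.
Proof. by rewrite sphere_intE//; exact: measurable_fun_pair2 mG. Qed.

Lemma sphere_int_ge0 x : 0 <= sphere_int (G x).
Proof. by rewrite sphere_intH; exact: integral_ge0. Qed.

Lemma measurable_sphere_int : measurable_fun setT (fun x => sphere_int (G x)).
Proof.
under eq_fun do rewrite sphere_intH.
exact: measurable_fun_fubini_tonelli_F.
Qed.

Lemma integral_sphere_int :
  \int[mu]_x sphere_int (G x) = sphere_int (fun n => \int[mu]_x G x n).
Proof.
under eq_integral do rewrite sphere_intH.
have mI : measurable_fun setT (fun n : R * R * R => \int[mu]_x G x n).
  by apply: (@measurable_fun_fubini_tonelli_G _ _ _ _ _ mu _ mG) => p; exact: G0.
rewrite sphere_intE//; last by move=> n; exact: integral_ge0.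
transitivity (\int[leb2_sf R]_a \int[mu]_x H (x, a)).
  exact: (fubini_tonelli (m1 := mu) (m2 := leb2_sf R) H mH H0).
apply: eq_integral => a _.
rewrite /H /= ge0_integralZr//.
- exact: measurable_fun_pair1 mG.
- by rewrite lee_fin sph_weight_ge0.
Qed.

End sphere.

Section sphere_scaling.
Context (R : realType) d (T : measurableType d).
Context (mu : {sigma_finite_measure set T -> \bar R}).
Local Open Scope ereal_scope.

(** After exchanging the integrals, [G] and [H] need only be compared for each fixed [n], where a
    change of variables depending on [n] is available. *)
Lemma integral_sphere_int_scale (k : R) (G H : T -> V R -> \bar R) : (0 <= k)%R ->
  measurable_fun setT (fun p : T * (R * R * R) => G p.1 p.2) ->
  measurable_fun setT (fun p : T * (R * R * R) => H p.1 p.2) ->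
  (forall x n, 0 <= G x n) -> (forall x n, 0 <= H x n) ->
  (forall n, nrm2 n = 1%R -> \int[mu]_x G x n = k%:E * \int[mu]_x H x n) ->
  \int[mu]_x sphere_int (G x) = k%:E * \int[mu]_x sphere_int (H x).
Proof.
move=> k0 mG mH G0 H0 GH; rewrite !integral_sphere_int// (eq_sphere_int GH).
apply: sphere_intZ => //; last by move=> n; exact: integral_ge0.
by apply: (@measurable_fun_fubini_tonelli_G _ _ _ _ _ mu _ mH) => p; exact: H0.
Qed.

End sphere_scaling.

(** * The stationary Maxwellian *)

Lemma nrm2_ge0 (R : realType) (v : V R) : 0 <= nrm2 v.
Proof. by rewrite /nrm2 /dot !addr_ge0// -expr2 sqr_ge0. Qed.

Lemma Maxw_ge0 (R : realType) (mass th : R) (u v : V R) : 0 <= Maxw mass th u v.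
Proof. by rewrite /Maxw mulr_ge0 ?powR_ge0 ?expR_ge0. Qed.

Lemma nrm2_translate (R : realType) (x n : V R) (t : R) :
  nrm2 (vadd x (vscale t n)) = nrm2 x + 2 * t * dot x n + t ^+ 2 * nrm2 n.
Proof.
by case: x n => [[x y] z] [[a b] c]; rewrite /nrm2 /dot /vadd /vscale /vec /=; ring.
Qed.

Section collision_identity.
Context (R : realType) (m m1 eps th1 : R) (u1 : V R).
Hypotheses (hm : 0 < m) (hm1 : 0 < m1) (heps0 : 0 < eps) (heps1 : eps < 1).
Hypothesis hth1 : 0 < th1.

Local Notation M := (Mhash m m1 eps th1 u1).
Local Notation N := (M1 m1 th1 u1).

Lemma th_sharp_gt0 : 0 < th_sharp m m1 eps th1.
Proof.
have s0 : 0 < m + m1 by exact: addr_gt0.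
have a : alpha m m1 * (m + m1) = m1 by rewrite /alpha mulfVK// gt_eqF.
have a0 : 0 < alpha m m1 by rewrite divr_gt0.
have a1 : alpha m m1 < 1 by rewrite /alpha ltr_pdivrMr// mul1r ltrDr.
have [b0 b1] : 0 < 1 - beta eps /\ 1 - beta eps < 1.
  by move: heps0 heps1; rewrite /beta; split; lra.
rewrite mulr_gt0// divr_gt0//; first by rewrite mulr_gt0// subr_gt0.
by rewrite subr_gt0 mulr_ilt1//; exact: ltW.
Qed.

(** Since [1 - beta = (1 + eps) / 2] and [1 - 2 * beta = eps], the coefficients reduce to [k]. The
    third identity characterises the temperature [th_sharp]: it makes the exponents cancel in
    [Maxw_shrink]. *)
Lemma gam_th_sharp (k := alpha m m1 * (1 + eps)) :
  [/\ 2 * gam m m1 eps * eps = k,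
      2 * gambar m m1 eps * eps = 1 + eps - k &
      m / th_sharp m m1 eps th1 * k = m1 / th1 * (2 - k)].
Proof.
have s0 : m + m1 != 0 by rewrite gt_eqF// addr_gt0.
have e0 : eps != 0 by rewrite gt_eqF.
have t0 : th1 != 0 by rewrite gt_eqF.
have m0 : m != 0 by rewrite gt_eqF.
rewrite /k /th_sharp /gam /gambar /alpha /beta.
have e2 : 1 - (1 - eps) != 0 by rewrite subKr.
have e3 : 2 - (1 - eps) != 0.
  by rewrite gt_eqF//; move: heps0; lra.
have d0 : (m + m1) * 2 - m1 * (2 - (1 - eps)) != 0.
  by rewrite gt_eqF//; move: hm hm1 heps1; nra.
split; first by field; rewrite s0.
- by field; rewrite s0.
- by field; rewrite s0 t0 d0 e3 addrK.
Qed.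

Lemma dot_shrink (v w n : V R) : nrm2 n = 1 ->
  dot (vsub v (shrink (1 - eps) v n w)) n = eps * dot (vsub v w) n.
Proof.
case: v w n => [[v1 v2] v3] [[w1 w2] w3] [[a b] c].
rewrite /nrm2 /shrink /dot /vsub /vadd /vscale /vec /= => n1.
transitivity ((1 - (1 - eps) * (a * a + b * b + c * c)) *
  ((v1 + -1 * w1) * a + (v2 + -1 * w2) * b + (v3 + -1 * w3) * c)); first by ring.
by rewrite n1; ring.
Qed.

(* In the inelastic case detailed balance holds only after the change of
   variables [shrink (1 - eps) v n], which scales the normal relative velocity
   by eps (see [dot_shrink]). *)
Lemma Maxw_shrink (v w n : V R) : nrm2 n = 1 ->
  let w' := shrink (1 - eps) v n w in
  M (vstar m m1 eps v w' n) * N (wstar m m1 eps v w' n) = M v * N w.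
Proof.
move=> n1 w'; have rE := dot_shrink v w n1.
have [kE kbE kth] := gam_th_sharp.
set k := alpha m m1 * (1 + eps) in kE kbE kth.
pose r := dot (vsub v w) n.
(* In terms of the relative velocity [r] before shrinking, both displacements are multiples of
   [r n]: the factor is [- k] for [v], and for [w] it is [1 - eps] from the shrinking plus
   [1 + eps - k] from the collision. *)
have vE : vsub (vstar m m1 eps v w' n) u1 =
    vadd (vsub v u1) (vscale (- (k * r)) n).
  rewrite /vstar rE -kE /r; move: (dot _ _) => s.
  case: (v) (u1) (n) => [[v1 v2] v3] [[a1 a2] a3] [[b1 b2] b3].
  by rewrite /vsub /vadd /vscale /vec /=; congr (_, _, _); ring.
have wE : vsub (wstar m m1 eps v w' n) u1 =
    vadd (vsub w u1) (vscale ((2 - k) * r) n).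
  have -> : 2 - k = 1 - eps + 2 * gambar m m1 eps * eps by rewrite kbE; ring.
  rewrite /wstar rE /w' /shrink /r; move: (dot _ _) => s.
  case: (w) (u1) (n) => [[v1 v2] v3] [[a1 a2] a3] [[b1 b2] b3].
  by rewrite /vsub /vadd /vscale /vec /=; congr (_, _, _); ring.
have dE : dot (vsub w u1) n = dot (vsub v u1) n - r.
  rewrite /r; case: (v) (w) (u1) (n) => [[? ?] ?] [[? ?] ?] [[? ?] ?] [[? ?] ?].
  by rewrite /dot /vsub /vadd /vscale /vec /=; ring.
rewrite /Mhash /M1 /Maxw vE wE.
rewrite (nrm2_translate (vsub v u1)) (nrm2_translate (vsub w u1)) n1 dE.
rewrite mulrACA -expRD [in RHS]mulrACA -expRD; congr (_ * expR _).
have t1 : th1 != 0 by rewrite gt_eqF.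
have t2 : th_sharp m m1 eps th1 != 0 by rewrite gt_eqF// th_sharp_gt0.
move: kth; move: (th_sharp _ _ _ _) t2 => t t2 kth.
move: (nrm2 (vsub v u1)) (nrm2 (vsub w u1)) (dot _ _) (r) => A B s q.
(* The change of the exponent factors through [m / t * k - m1 / th1 * (2 - k)], which vanishes by
   [kth]. *)
have -> : - (m * (A + 2 * - (k * q) * s + (- (k * q)) ^+ 2 * 1)) / (2 * t) +
  - (m1 * (B + 2 * ((2 - k) * q) * (s - q) + ((2 - k) * q) ^+ 2 * 1)) / (2 * th1)
  = - (m * A) / (2 * t) + - (m1 * B) / (2 * th1)
    + (m / t * k - m1 / th1 * (2 - k)) * (q * s - k * q ^+ 2 / 2).
  by field; rewrite t1 t2.
by rewrite kth subrr mul0r addr0.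
Qed.

End collision_identity.

(** * Finiteness of second moments of Maxwellians *)

Section gaussian_moments.
Context (R : realType).
Local Open Scope ereal_scope.

Lemma integral_gauss1_lty (b u : R) : (0 < b)%R ->
  \int[leb (R:=R)]_x (expR (- (b * (x - u) ^+ 2)))%:E < +oo.
Proof.
move=> b0; have s0 : (0 < Num.sqrt b)%R by rewrite sqrtr_gt0.
have := @integral_affine R (Num.sqrt b) (- (Num.sqrt b * u))%R
  (fun x => (gauss_fun x)%:E) s0.
rewrite (_ : (fun x : R => (gauss_fun (Num.sqrt b * x + - (Num.sqrt b * u)))%:E) =
   (fun x => (expR (- (b * (x - u) ^+ 2)))%:E)); last first.
  apply/funext => x; rewrite /gauss_fun; congr (expR (- _))%:E.
  by rewrite -mulrBr exprMn sqr_sqrtr// ltW.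
move=> ->.
- by rewrite /leb integralT_gauss -EFinM ltry.
- by apply/measurable_EFinP; exact: measurable_gauss_fun.
- by move=> x; rewrite lee_fin gauss_fun_ge0.
Qed.

Lemma integral_gauss3_lty (b : R) (u : V R) : (0 < b)%R ->
  \int[leb3 (R:=R)]_w (expR (- (b * nrm2 (vsub w u))))%:E < +oo.
Proof.
move=> b0; rewrite integral_leb3E.
pose e (c x : R) := expR (- (b * (x - c) ^+ 2)).
have me c : measurable_fun setT (e c).
  apply: measurableT_comp => //; apply: measurable_funN.
  apply: measurable_funM => //; apply: measurable_funX.
  exact: measurable_funB.
have e0 c x : (0 <= e c x)%R by exact: expR_ge0.
rewrite (_ : (fun w => _) = (fun w : R * R * R =>
    ((fun p : R * R => e u.1.1 p.1 * e u.1.2 p.2) w.1 * e u.2 w.2)%R%:E)).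
  apply: (integral_prod_mul_lty (m1 := leb2_sf R) (m2 := @lebesgue_measure R)
    (f := fun p : R * R => (e u.1.1 p.1 * e u.1.2 p.2)%R)) => //.
  - by apply: measurable_funM; exact: measurableT_comp.
  - exact: me.
  - by move=> x; rewrite mulr_ge0.
  - apply: (integral_prod_mul_lty (m1 := @lebesgue_measure R)
      (m2 := @lebesgue_measure R) (me _) (me _)) => //.
    + exact: (integral_gauss1_lty u.1.1 b0).
    + exact: (integral_gauss1_lty u.1.2 b0).
  - exact: (integral_gauss1_lty u.2 b0).
apply/funext => -[[x y] z]; rewrite /e -!expRD; congr (expR _)%:E.
by rewrite /nrm2 /dot /vsub /vadd /vscale /vec /=; ring.
Qed.

(** Half of the Gaussian exponent absorbs the quadratic factor; the other half is still an
    integrable Gaussian. *)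
Lemma integral_Maxw_moment_lty (mass th : R) (u : V R) : (0 < mass)%R -> (0 < th)%R ->
  \int[leb3 (R:=R)]_w ((1 + nrm2 (vsub w u)) * Maxw mass th u w)%:E < +oo.
Proof.
move=> mass0 th0; pose a := (mass / (2 * th))%R.
have a0 : (0 < a)%R by rewrite divr_gt0// mulr_gt0.
pose C := ((mass / (2 * pi * th)) `^ (3 / 2))%R.
have C0 : (0 <= C)%R by exact: powR_ge0.
(* From [1 + a / 2 * t <= expR (a / 2 * t)] one gets [(1 + t) * expR (- (a / 2 * t)) <= 1 + 2 /
   a]. *)
pose K := (C * (1 + 2 / a))%R.
have K0 : (0 <= K)%R by rewrite mulr_ge0// addr_ge0// divr_ge0// ltW.
have mE : measurable_fun setT (fun w : R * R * R =>
    (expR (- (a / 2 * nrm2 (vsub w u))))%:E).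
  apply/measurable_EFinP; apply: measurableT_comp => //; apply: measurable_funN.
  apply: measurable_funM => //.
  by apply: measurable_dot; exact: measurable_vsub.
apply: (@le_lt_trans _ _ (K%:E * \int[leb3 (R:=R)]_w
    (expR (- (a / 2 * nrm2 (vsub w u))))%:E)); last first.
  by apply: lte_mul_pinfty => //; apply: integral_gauss3_lty; rewrite divr_gt0.
rewrite !integral_leb3E -ge0_integralZl//.
apply: ge0_le_integral => //.
- by move=> w _; rewrite lee_fin mulr_ge0 ?Maxw_ge0// addr_ge0// nrm2_ge0.
- apply/measurable_EFinP; apply: measurable_funM; last exact: measurable_Maxw.
  apply: measurable_funD => //.
  by apply: measurable_dot; exact: measurable_vsub.
- by apply: measurable_funeM.
move=> w _; rewrite -EFinM lee_fin /Maxw -/C.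
have -> : (- (mass * nrm2 (vsub w u)) / (2 * th) = - (a * nrm2 (vsub w u)))%R.
  by rewrite /a; field; rewrite gt_eqF.
have := nrm2_ge0 (vsub w u).
move: (nrm2 _) => t t0.
have -> : (- (a * t) = - (a / 2 * t) + - (a / 2 * t))%R by field.
rewrite expRD; set E := expR _.
have -> : ((1 + t) * (C * (E * E)) = C * E * ((1 + t) * E))%R by ring.
have -> : (K * E = C * E * (1 + 2 / a))%R by rewrite /K; ring.
rewrite ler_wpM2l ?mulr_ge0 ?expR_ge0// /E.
rewrite expRN ler_pdivrMr ?expR_gt0//.
apply: (@le_trans _ _ ((1 + 2 / a) * (1 + a / 2 * t))%R); last first.
  by rewrite ler_wpM2l ?expR_ge1Dx// addr_ge0// divr_ge0// ltW.
have -> : ((1 + 2 / a) * (1 + a / 2 * t) = 1 + t + (2 / a + a / 2 * t))%R.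
  by field; rewrite gt_eqF.
have a0' := ltW a0; rewrite lerDl; apply: addr_ge0; first exact: divr_ge0.
by apply: mulr_ge0 => //; exact: divr_ge0.
Qed.

End gaussian_moments.

(** * Balance of gain and loss, and growth of the collision frequency *)

Section balance.
Context (R : realType) (m m1 eps th1 : R) (u1 : V R).
Hypotheses (hm : 0 < m) (hm1 : 0 < m1) (heps0 : 0 < eps) (heps1 : eps < 1).
Hypothesis hth1 : 0 < th1.

Local Notation M := (Mhash m m1 eps th1 u1).
Local Notation N := (M1 m1 th1 u1).

Let gain (v w n : V R) : \bar R :=
  (`|dot (vsub v w) n| * M (vstar m m1 eps v w n) * N (wstar m m1 eps v w n))%:E.
Let loss (v w n : V R) : \bar R := (`|dot (vsub v w) n| * N w)%:E.

Let measurable_gain v :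
  measurable_fun setT (fun p : (R * R * R) * (R * R * R) => gain v p.1 p.2).
Proof.
have mv := @measurable_cst _ _ ((R * R * R) * (R * R * R))%type (R * R * R)%type setT v.
have mf := @measurable_fst _ _ (R * R * R)%type (R * R * R)%type.
have ms := @measurable_snd _ _ (R * R * R)%type (R * R * R)%type.
have md := measurable_dot (measurable_vsub mv mf) ms.
apply/measurable_EFinP; apply: measurable_funM; first apply: measurable_funM.
- exact: measurableT_comp.
- apply: measurable_Maxw; apply: measurable_vsub => //.
  by apply: measurable_vscale => //; exact: measurable_funM.
- apply: measurable_Maxw; apply: measurable_vadd => //.
  by apply: measurable_vscale => //; exact: measurable_funM.
Qed.

Let measurable_loss : measurable_fun setT
  (fun p : ((R * R * R) * (R * R * R)) * (R * R * R) => loss p.1.1 p.1.2 p.2).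
Proof.
have mf := @measurable_fst _ _ ((R * R * R) * (R * R * R))%type (R * R * R)%type.
have m1' := measurableT_comp (@measurable_fst _ _ (R * R * R)%type (R * R * R)%type) mf.
have m2' := measurableT_comp (@measurable_snd _ _ (R * R * R)%type (R * R * R)%type) mf.
have m3 := @measurable_snd _ _ ((R * R * R) * (R * R * R))%type (R * R * R)%type.
apply/measurable_EFinP; apply: measurable_funM; last exact: (measurable_Maxw _ _ _ m2').
apply: measurableT_comp => //.
exact: (measurable_dot (measurable_vsub m1' m2') m3).
Qed.

Let measurable_loss2 v : measurable_fun setT
  (fun p : (R * R * R) * (R * R * R) => loss v p.1 p.2).
Proof.
have mp : measurable_fun setT (fun p : (R * R * R) * (R * R * R) => ((v, p.1), p.2)).
  apply: measurable_fun_pair => //; exact: measurable_fun_pair.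
exact: (measurableT_comp measurable_loss mp).
Qed.

Let gain_ge0 v w n : (0 <= gain v w n)%E.
Proof. by apply: mulr_ge0; [apply: mulr_ge0 => //|]; exact: Maxw_ge0. Qed.

Let loss_ge0 v w n : (0 <= loss v w n)%E.
Proof. by apply: mulr_ge0 => //; exact: Maxw_ge0. Qed.

(** One factor [eps] is the Jacobian of [shrink (1 - eps) v n], the other comes from the scaling of
    [|q . n|]. *)
Let integral_gain v n : nrm2 n = 1 ->
  (\int[@leb3 R]_w gain v w n =
   (eps ^+ 2 * M v)%:E * \int[@leb3 R]_w loss v w n)%E.
Proof.
move=> n1.
have e1 : 0 < 1 - eps < 1 by apply/andP; split; move: heps0 heps1; lra.
have mg : measurable_fun setT (fun w : R * R * R => gain v w n).
  exact: measurable_fun_pair1 (measurable_gain v).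
have := integral_shrink v e1 n1 mg (fun w => gain_ge0 v w n).
rewrite subKr => h.
have -> : (\int[@leb3 R]_w gain v w n =
    eps%:E * \int[@leb3 R]_w gain v (shrink (1 - eps) v n w) n)%E.
  by rewrite h muleA -EFinM mulfV ?mul1e// gt_eqF.
have ml : measurable_fun setT (fun w : R * R * R => loss v w n).
  exact: measurable_fun_pair1 (measurable_loss2 v).
rewrite (_ : (fun w => _) = fun w => ((eps * M v)%:E * loss v w n)%E); last first.
  apply/funext => w; rewrite /gain /loss -EFinM; congr EFin.
  rewrite -mulrA (Maxw_shrink u1 hm hm1 heps0 heps1 hth1)// dot_shrink//.
  by rewrite normrM (gtr0_norm heps0); ring.
rewrite integral_leb3E ge0_integralZl//; last first.
  by apply: mulr_ge0; [exact: ltW|exact: Maxw_ge0].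
by rewrite muleA -EFinM mulrA -expr2.
Qed.

Let Sigma v : \bar R := (\int[leb3_sf R]_w sphere_int (loss v w))%E.

Lemma Qplus_Mhash v : Qplus m m1 eps th1 u1 M v = sigma m1 th1 u1 v * M v.
Proof.
have k0 : 0 <= eps ^+ 2 * M v by apply: mulr_ge0; [exact: sqr_ge0|exact: Maxw_ge0].
have -> : sigma m1 th1 u1 v = fine (Sigma v) by [].
have -> : Qplus m m1 eps th1 u1 M v =
  eps ^- 2 * fine (\int[leb3_sf R]_w sphere_int (gain v w))%E by [].
have gE : (\int[leb3_sf R]_w sphere_int (gain v w) = (eps ^+ 2 * M v)%:E * Sigma v)%E.
  have := integral_sphere_int_scale (mu := leb3_sf R) (G := gain v) (H := loss v)
    k0 (measurable_gain v) (measurable_loss2 v) (gain_ge0 v) (loss_ge0 v).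
  apply => n n1; exact: integral_gain.
have S0 : (0 <= Sigma v)%E.
  by apply: integral_ge0 => w _; exact: (sphere_int_ge0 (measurable_loss2 v) (loss_ge0 v)).
rewrite gE.
have e2 : eps ^+ 2 != 0 by rewrite expf_neq0// gt_eqF.
(* When [Sigma v] is infinite, [fine +oo = 0] makes both sides zero. *)
case: (Sigma v) S0 => [r||]//= _; first by field; rewrite gt_eqF.
move: k0; rewrite le_eqVlt => /predU1P[<-|k0]; first by rewrite mul0e /= mulr0 mul0r.
by rewrite gt0_muley ?lte_fin//= mulr0 mul0r.
Qed.

Lemma Mhash_gt0 v : 0 < M v.
Proof.
have t0 := th_sharp_gt0 hm hm1 heps0 heps1 hth1.
apply: mulr_gt0; last exact: expR_gt0.
apply: powR_gt0; apply: divr_gt0 => //; apply: mulr_gt0 => //.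
by apply: mulr_gt0 => //; exact: pi_gt0.
Qed.

Lemma measurable_sigma : measurable_fun setT (sigma m1 th1 u1 : R * R * R -> R).
Proof.
have mS := measurable_sphere_int measurable_loss (fun p n => loss_ge0 p.1 p.2 n).
have S0 p : (0 <= sphere_int (loss p.1 p.2))%E.
  exact: (sphere_int_ge0 (measurable_loss2 p.1) (loss_ge0 p.1)).
exact: (measurableT_comp (@fine_measurable R setT measurableT)
  (measurable_fun_fubini_tonelli_F (m2 := leb3_sf R) _ mS S0)).
Qed.

Let mom (v : V R) : R := 1 + nrm2 (vsub v u1).

Let mom_ge0 v : 0 <= mom v.
Proof. by rewrite addr_ge0// nrm2_ge0. Qed.

Let measurable_mom : measurable_fun setT (mom : R * R * R -> R).
Proof.
by apply: measurable_funD => //; apply: measurable_dot; exact: measurable_vsub.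
Qed.

(** Expanding [|x + n|^2 >= 0] and [|x - n|^2 >= 0] gives [2 |x . n| <= 1 + |x|^2], applied to
    [v - u1] and [w - u1]. The product form separates the variables, so integrating over [w] leaves
    a constant times [mom v]. *)
Lemma norm_dot_le (v w n : V R) : nrm2 n = 1 ->
  `|dot (vsub v w) n| <= mom v * mom w.
Proof.
move=> n1; set a := vsub v u1; set b := vsub w u1.
have qE : dot (vsub v w) n = dot a n - dot b n.
  rewrite /a /b; case: (v) (w) (u1) (n) => [[? ?] ?] [[? ?] ?] [[? ?] ?] [[? ?] ?].
  by rewrite /dot /vsub /vadd /vscale /vec /=; ring.
have sq (x : V R) t : 0 <= nrm2 x + 2 * t * dot x n + t ^+ 2.
  by have := nrm2_ge0 (vadd x (vscale t n)); rewrite nrm2_translate n1 mulr1.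
have := sq a 1; have := sq a (-1); have := sq b 1; have := sq b (-1).
have := nrm2_ge0 a; have := nrm2_ge0 b.
rewrite qE /mom -/a -/b sqrrN expr1n.
move: (nrm2 a) (nrm2 b) (dot a n) (dot b n) => A B s t B0 A0 h1 h2 h3 h4.
have AB : 0 <= A * B by exact: mulr_ge0.
rewrite ler_norml; apply/andP; split; lra.
Qed.

Let S : \bar R := (\int[leb2_sf R]_a (sph_weight a)%:E)%E.

(** The weight is at most 1 and supported on a bounded rectangle. *)
Let S_lty : (S < +oo)%E.
Proof.
pose D : set R := `[0, pi]%classic; pose E : set R := `[0, 2 * pi]%classic.
have itv_lty (c : R) : (lebesgue_measure (`[0%R, c]%classic : set R) < +oo)%E.
  by rewrite lebesgue_measure_itv/=; case: ifPn => _; rewrite ?ltry// -EFinB ltry.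
have mD : measurable D by exact: measurable_itv.
have mE : measurable E by exact: measurable_itv.
apply: (@le_lt_trans _ _ (\int[leb2_sf R]_a (\1_D a.1 * \1_E a.2)%:E)%E).
  apply: ge0_le_integral => //.
  - by move=> a _; rewrite lee_fin sph_weight_ge0.
  - by apply/measurable_EFinP; exact: measurable_sph_weight.
  - apply/measurable_EFinP; apply: measurable_funM;
      by apply: measurableT_comp => //; exact: measurable_indic.
  - move=> a _; rewrite lee_fin /sph_weight ler_wpM2r// ?indicE//.
    by rewrite -[leRHS]mul1r ler_wpM2r// sin_le1.
apply: (integral_prod_mul_lty (m1 := @lebesgue_measure R) (m2 := @lebesgue_measure R)).
- exact: measurable_indic.
- exact: measurable_indic.
- by move=> x; rewrite indicE.
- by move=> x; rewrite indicE.
- by rewrite integral_indic// setIT; exact: itv_lty.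
- by rewrite integral_indic// setIT; exact: itv_lty.
Qed.

Let S_ge0 : (0 <= S)%E.
Proof. by apply: integral_ge0 => a _; rewrite lee_fin sph_weight_ge0. Qed.

Let sphere_loss_le v w :
  (sphere_int (loss v w) <= (mom v * (mom w * N w))%:E * S)%E.
Proof.
have ml : measurable_fun setT (loss v w : R * R * R -> \bar R).
  exact: measurable_fun_pair2 (measurable_loss2 v).
have c0 : 0 <= mom v * (mom w * N w).
  by do 2!apply: mulr_ge0 => //; exact: Maxw_ge0.
have mwt : measurable_fun setT (fun a : R * R => (sph_weight a)%:E).
  by apply/measurable_EFinP; exact: measurable_sph_weight.
have wt0 a : (0 <= (sph_weight a : R)%:E)%E by rewrite lee_fin sph_weight_ge0.
have <- : (\int[leb2_sf R]_a ((mom v * (mom w * N w))%:E * (sph_weight a)%:E) =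
    (mom v * (mom w * N w))%:E * S)%E.
  by apply: ge0_integralZl => //; rewrite lee_fin.
rewrite sphere_intE//; apply: ge0_le_integral => //.
- by move=> a _; exact: mule_ge0.
- apply: emeasurable_funM => //.
  exact: (measurableT_comp ml (@measurable_sph_pair R)).
- exact: measurable_funeM.
move=> a _; apply: lee_wpmul2r; first exact: wt0.
rewrite /loss lee_fin mulrA; apply: ler_wpM2r; first exact: Maxw_ge0.
by apply: norm_dot_le; exact: nrm2_sph.
Qed.

Let KN : \bar R := (\int[leb3_sf R]_w (mom w * N w)%:E)%E.

Let measurable_mom_Maxw (mass th : R) :
  measurable_fun setT (fun w : R * R * R => (mom w * Maxw mass th u1 w)%:E).
Proof.
by apply/measurable_EFinP; apply: measurable_funM => //; exact: measurable_Maxw.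
Qed.

Let Sigma_le v : (Sigma v <= (mom v)%:E * (KN * S))%E.
Proof.
rewrite /Sigma /KN.
have m0 (w : V R) : (0 <= (mom w * N w)%:E)%E.
  by rewrite lee_fin mulr_ge0// Maxw_ge0.
rewrite -ge0_integralZr//; last exact: measurable_mom_Maxw.
rewrite -ge0_integralZl//; last 3 first.
- by apply: emeasurable_funM => //; exact: measurable_mom_Maxw.
- by move=> w _; exact: mule_ge0.
- by rewrite lee_fin.
apply: ge0_le_integral => //.
- by move=> w _; exact: (sphere_int_ge0 (measurable_loss2 v) (loss_ge0 v)).
- exact: (measurable_sphere_int (measurable_loss2 v) (loss_ge0 v)).
- apply: measurable_funeM; apply: emeasurable_funM => //.
  exact: measurable_mom_Maxw.
by move=> w _; rewrite muleA -EFinM; exact: sphere_loss_le.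
Qed.

Lemma integrable_Mhash : L1 M.
Proof.
apply/integrableP; split; first by apply/measurable_EFinP; exact: measurable_Maxw.
apply: le_lt_trans (integral_Maxw_moment_lty u1 hm (th_sharp_gt0 hm hm1 heps0 heps1 hth1)).
rewrite !integral_leb3E; apply: ge0_le_integral => //.
- by do 2!apply: measurableT_comp => //; exact: measurable_Maxw.
- exact: measurable_mom_Maxw.
move=> w _ /=; rewrite lee_fin ger0_norm ?Maxw_ge0//.
by rewrite ler_peMl ?Maxw_ge0// lerDl nrm2_ge0.
Qed.

(** By [Sigma_le], [sigma] is at most a constant times [mom], and [mom * M] is integrable. With
    [integrable_Mhash] this gives access to [gen_extends_LBE] at [M]. *)
Lemma integrable_sigma_Mhash : L1 (fun v => sigma m1 th1 u1 v * M v).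
Proof.
have mM : measurable_fun setT (M : R * R * R -> R) by exact: measurable_Maxw.
apply/integrableP; split.
  by apply/measurable_EFinP; apply: measurable_funM => //; exact: measurable_sigma.
have KN0 : (0 <= KN)%E.
  by apply: integral_ge0 => w _; rewrite lee_fin mulr_ge0// Maxw_ge0.
have KNlty : (KN < +oo)%E by exact: integral_Maxw_moment_lty.
have c_lty : (KN * S < +oo)%E by rewrite lte_mul_pinfty// ge0_fin_numE.
have cE : (KN * S = (fine (KN * S))%:E)%E by rewrite fineK// ge0_fin_numE ?mule_ge0.
set c := fine _ in cE.
have c0 : 0 <= c by rewrite /c fine_ge0// mule_ge0.
have sigma_le v : 0 <= sigma m1 th1 u1 v <= mom v * c.
  have S0 : (0 <= Sigma v)%E.
    by apply: integral_ge0 => w _; exact: (sphere_int_ge0 (measurable_loss2 v) (loss_ge0 v)).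
  have -> : sigma m1 th1 u1 v = fine (Sigma v) by [].
  have := Sigma_le v; rewrite cE -EFinM.
  by case: (Sigma v) S0 => //= r; rewrite !lee_fin => -> ->.
apply: (@le_lt_trans _ _ (c%:E * \int[@leb3 R]_w (mom w * M w)%:E)%E); last first.
  apply: lte_mul_pinfty => //; apply: integral_Maxw_moment_lty => //.
  exact: th_sharp_gt0.
rewrite !integral_leb3E -ge0_integralZl//; last 2 first.
- exact: measurable_mom_Maxw.
- by move=> w _; rewrite lee_fin mulr_ge0// Maxw_ge0.
apply: ge0_le_integral => //.
- do 2!apply: measurableT_comp => //; apply: measurable_funM => //.
  exact: measurable_sigma.
- by apply: measurable_funeM; exact: measurable_mom_Maxw.
move=> w _ /=; have /andP[s0 sc] := sigma_le w.
rewrite -EFinM lee_fin ger0_norm; last by apply: mulr_ge0 => //; exact: Maxw_ge0.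
have -> : c * (mom w * M w) = mom w * c * M w by ring.
by apply: ler_wpM2r => //; exact: Maxw_ge0.
Qed.

End balance.

(** * Fixed points of the semigroup *)

(** Lets [filterS] act on almost-everywhere statements phrased with [leb3]. *)
#[local] Instance ae_leb3_filter (R : realType) :
   Filter (almost_everywhere (@leb3 R)).
Proof. exact: (ae_filter_ringOfSetsType (leb3_sf R)). Qed.

Section semigroup_fixed_points.
Context (R : realType).
Implicit Types f g : V R -> R.

Lemma norm1_ge0 f : (0 <= norm1 f)%E.
Proof. by apply: integral_ge0 => x _; rewrite lee_fin. Qed.

Lemma L1_measurable f : L1 f -> measurable_fun setT (f : R * R * R -> R).
Proof. by move=> fi; apply/measurable_EFinP; case/integrableP: fi. Qed.

Lemma L1_lincomb (a b : R) f g : L1 f -> L1 g -> L1 (fun v => a * f v + b * g v).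
Proof. exact: integrable_lincomb. Qed.

Lemma L1_sub f g : L1 f -> L1 g -> L1 (fun v => f v - g v).
Proof.
move=> fi gi; have := L1_lincomb 1 (-1) fi gi.
by congr L1; apply/funext => v; rewrite mul1r mulN1r.
Qed.

Lemma measurable_norm f : L1 f ->
  measurable_fun setT (fun v : R * R * R => `|f v|%:E).
Proof.
move=> /L1_measurable mf; apply/measurable_EFinP; exact: measurableT_comp.
Qed.

Lemma norm1_ae_eq f g : L1 f -> L1 g -> Defs.ae_eq f g -> norm1 f = norm1 g.
Proof.
move=> fi gi fg; rewrite /norm1 !integral_leb3E; apply: ae_eq_integral => //.
- exact: measurable_norm.
- exact: measurable_norm.
- by apply: filterS fg => x fgx _; rewrite /= fgx.
Qed.

Lemma norm1_triangle f g : L1 f -> L1 g ->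
  (norm1 (fun v => (f v + g v)%R) <= norm1 f + norm1 g)%E.
Proof.
move=> fi gi; have mf := L1_measurable fi; have mg := L1_measurable gi.
rewrite /norm1 !integral_leb3E -ge0_integralD//; last 2 first.
- exact: measurable_norm.
- exact: measurable_norm.
apply: ge0_le_integral => //.
- by apply/measurable_EFinP; apply: measurableT_comp => //; exact: measurable_funD.
- by apply: emeasurable_funD; exact: measurable_norm.
- by move=> x _; rewrite -EFinD lee_fin ler_normD.
Qed.

Lemma norm1Z (a : R) f : L1 f -> norm1 (fun v => a * f v) = (`|a|%:E * norm1 f)%E.
Proof.
move=> fi; rewrite /norm1 !integral_leb3E -ge0_integralZl//; last exact: measurable_norm.
by apply: eq_integral => x _; rewrite normrM EFinM.
Qed.

Lemma norm1_eq0 f : L1 f -> norm1 f = 0%E -> Defs.ae_eq f (fun=> 0).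
Proof.
move=> fi; rewrite /norm1 integral_leb3E => n0.
have mf : measurable_fun setT (fun v : R * R * R => (f v)%:E).
  by apply/measurable_EFinP; exact: L1_measurable.
have /(_ (fun v => (f v)%:E) mf) [+ _] :=
  @ae_eq_integral_abs _ _ _ (leb3_sf R) setT measurableT.
by move=> /(_ n0); apply: filterS => x /(_ I) [].
Qed.

Context (Z : R -> (V R -> R) -> (V R -> R)).
Hypotheses (Zsg : C0_semigroup Z) (Zcontr : contraction_sg Z).

(** [Z (n h) f - f] telescopes into the sum of [Z (j h) (Z h f - f)] over [j < n], and each term is
    controlled by contractivity. *)
Lemma semigroup_increment f (h : R) n : L1 f -> 0 <= h ->
  (norm1 (fun v => (Z (n%:R * h) f v - f v)%R) <=
   n%:R%:E * norm1 (fun v => (Z h f v - f v)%R))%E.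
Proof.
case: Zsg => ZL1 Zae Zlin _ [Z0 Zadd _] fi h0.
elim: n => [|n IHn].
  have e : Defs.ae_eq (fun v => Z (0 * h) f v - f v) (fun=> 0).
    by rewrite mul0r; apply: filterS (Z0 f fi) => x ->; rewrite subrr.
  have L0 : L1 (fun _ : V R => 0 : R).
    have := L1_sub fi fi; congr L1; apply/funext => v; exact: subrr.
  rewrite mul0e (norm1_ae_eq _ L0 e); last by apply: L1_sub => //; apply: ZL1; rewrite ?mul0r.
  by rewrite /norm1 integral0_eq// => x _; rewrite normr0.
set s := n%:R * h; have s0 : 0 <= s by rewrite mulr_ge0.
have sE : n.+1%:R * h = s + h by rewrite /s -natr1 mulrDl mul1r.
set u := fun v => Z h f v - f v.
have hi := ZL1 h f h0 fi; have si := ZL1 s f s0 fi.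
have ui : L1 u by exact: L1_sub.
have Zui := ZL1 s u s0 ui.
have e : Defs.ae_eq (fun v => Z (n.+1%:R * h) f v - f v)
               (fun v => Z s u v + (Z s f v - f v)).
  have uE : u = (fun v => 1 * Z h f v + (-1) * f v).
    by apply/funext => v; rewrite mul1r mulN1r.
  have := Zlin s 1 (-1) _ _ s0 hi fi; rewrite -uE.
  have := Zadd s h f s0 h0 fi; rewrite -sE.
  apply: filterS2 => x -> ->; ring.
have wi : L1 (fun v => Z s f v - f v) by exact: L1_sub.
have Lr : L1 (fun v => Z s u v + (Z s f v - f v)).
  by have := L1_lincomb 1 1 Zui wi; congr L1; apply/funext => v; rewrite !mul1r.
have Ll : L1 (fun v => Z (n.+1%:R * h) f v - f v).
  by apply: L1_sub => //; apply: ZL1 => //; rewrite sE addr_ge0.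
rewrite (norm1_ae_eq Ll Lr e).
apply: (le_trans (norm1_triangle Zui wi)).
rewrite -natr1 EFinD ge0_muleDl// mul1e addeC; apply: leeD => //.
exact: Zcontr.
Qed.

(** With [h = t / n], the norm of [Z t f - f] is at most [t] times that of the difference quotient
    [(Z h f - f) / h], which tends to zero as [n] grows. *)
Lemma generator0_fixed f : L1 f -> generator_at Z f (fun=> 0) ->
  forall t, 0 <= t -> Defs.ae_eq (Z t f) f.
Proof.
move=> fi [_ _ gen] t t0; have [ZL1 _ _ _ _] := Zsg.
have [->|tN0] := eqVneq t 0; first by case: Zsg => _ _ _ _ [Z0 _ _]; exact: Z0.
have {tN0}t_gt0 : 0 < t by rewrite lt_neqAle eq_sym tN0.
have di : L1 (fun v => Z t f v - f v) by apply: L1_sub => //; exact: ZL1.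
have d0 : norm1 (fun v => Z t f v - f v) = 0%E.
  apply/eqP; rewrite eq_le norm1_ge0 andbT; apply/lee_addgt0Pr => e e0.
  rewrite add0e.
  have e1 : (0 < (e / t)%:E)%E by rewrite lte_fin divr_gt0.
  have /gen [d /= d_gt0 Hd] : nbhs 0%E [set x : \bar R | (x < (e / t)%:E)%E].
    by apply: (nbhs_open_ereal_lt (f := fun=> e / t)); rewrite divr_gt0.
  (* The successor makes [n] strictly larger than [t / d], so [h = t / n] lies below [d], where the
     quotient has norm less than [e / t]. *)
  pose n := (Num.truncn (t / d)).+1.
  have n0 : (0 : R) < n%:R by rewrite ltr0n.
  pose h := t / n%:R.
  have h0 : 0 < h by rewrite divr_gt0.
  have hd : h < d.
    by rewrite /h ltr_pdivrMr// mulrC -ltr_pdivrMr// truncnS_gt.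
  have tE : t = n%:R * h by rewrite /h; field; rewrite gt_eqF.
  have := Hd h; rewrite /= sub0r normrN (gtr0_norm h0) => /(_ hd h0).
  have ui : L1 (fun v => Z h f v - f v) by apply: L1_sub => //; apply: ZL1 => //; exact: ltW.
  have -> : (fun v => (Z h f v - f v) / h - 0) = (fun v => h^-1 * (Z h f v - f v)).
    by apply/funext => v; rewrite subr0 mulrC.
  rewrite norm1Z// gtr0_norm ?invr_gt0// => small.
  rewrite {1}tE; apply: (le_trans (semigroup_increment n fi (ltW h0))).
  have -> : (n%:R%:E * norm1 (fun v => (Z h f v - f v)%R) =
      t%:E * (h^-1%:E * norm1 (fun v => (Z h f v - f v)%R)))%E.
    rewrite muleA -EFinM; congr (_%:E * _)%E.
    by rewrite {1}tE mulfK// gt_eqF.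
  have -> : e = t * (e / t) by field; rewrite gt_eqF.
  by rewrite EFinM lee_wpmul2l ?lee_fin// ltW.
apply: filterS (norm1_eq0 di d0) => x; lra.
Qed.

End semigroup_fixed_points.

(** * The information as an integral of a real-valued density *)

Section information.
Context (R : realType).

(** Positivity of [g] excludes the infinite branch, and the convention at [f v = 0] agrees with
    [0 * ln 0 = 0]. *)
Lemma infoE (f g : V R -> R) : (forall v, 0 < g v) ->
  info f g = (\int[@leb3 R]_v (f v * ln (f v) - f v * ln (g v))%:E)%E.
Proof.
move=> g0; apply: eq_integral => v _; rewrite /info_density.
have [->|_] := eqVneq (f v) 0; first by rewrite !mul0r subrr.
by rewrite (gt_eqF (g0 v)).
Qed.

Lemma info_ae_eq (f f' g : V R -> R) : (forall v, 0 < g v) -> L1 f -> L1 f' ->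
  L1 g -> Defs.ae_eq f f' -> info f g = info f' g.
Proof.
move=> g0 fi fi' gi ff'; rewrite (infoE f g0) (infoE f' g0).
have m (u : V R -> R) : L1 u ->
    measurable_fun setT (fun v : R * R * R => (u v * ln (u v) - u v * ln (g v))%:E).
  move=> /L1_measurable mu; have mg := L1_measurable gi.
  apply/measurable_EFinP; apply: measurable_funB; apply: measurable_funM => //;
  by apply: measurableT_comp => //; exact: measurable_ln.
rewrite (integral_leb3E (fun v => (f v * ln (f v) - f v * ln (g v))%:E)).
rewrite (integral_leb3E (fun v => (f' v * ln (f' v) - f' v * ln (g v))%:E)).
apply: ae_eq_integral => //; [exact: m|exact: m|].
by apply: filterS ff' => v e _; rewrite /= e.
Qed.

End information.

Theorem theorem4p6 (R : realType) (m m1 eps th1 : R) (u1 : V R)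
  (hm : 0 < m) (hm1 : 0 < m1) (heps0 : 0 < eps) (heps1 : eps < 1) (hth1 : 0 < th1)
  (Z : R -> (V R -> R) -> (V R -> R))
  (hZ : minimal_LBE_semigroup m m1 eps th1 u1 Z)
  (f0 : V R -> R) (hf0 : L1 f0) (hf0pos : ae_le (fun=> 0) f0)
  (hmass : (\int[@leb3 R]_v (f0 v)%:E)%E = 1%E)
  (hinfo : (info f0 (Mhash m m1 eps th1 u1) < +oo)%E) :
  forall s t : R, 0 <= s -> s <= t ->
    (info (Z t f0) (Mhash m m1 eps th1 u1) <= info (Z s f0) (Mhash m m1 eps th1 u1))%E.
Proof.
move=> s t s0 st; case: hZ => -[Zsg Zpos Zcontr Zgen] _.
set M := Mhash m m1 eps th1 u1.
have M0 v : 0 < M v by exact: Mhash_gt0.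
have Mi : L1 M by exact: integrable_Mhash.
(* Gain and loss cancel pointwise at [M], so the generator vanishes there. *)
have gM : generator_at Z M (fun=> 0).
  have := Zgen M Mi (integrable_sigma_Mhash u1 hm hm1 heps0 heps1 hth1).
  congr generator_at; apply/funext => v.
  by rewrite Qplus_Mhash// addrC subrr.
have r0 : 0 <= t - s by rewrite subr_ge0.
have ZM := generator0_fixed Zsg Zcontr Mi gM r0.
have [ZL1 _ Zlin _ [_ Zadd _]] := Zsg.
have Zsi := ZL1 s f0 s0 hf0.
have Zri := ZL1 _ _ r0 Zsi.
(* The evolution from [s] to [t] is the single positive contraction [Z (t - s)], which fixes [M],
   applied to [Z s f0]. *)
have e : Defs.ae_eq (Z t f0) (Z (t - s) (Z s f0)).
  by have := Zadd (t - s) s f0 r0 s0 hf0; rewrite subrK.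
rewrite (info_ae_eq M0 _ Zri Mi e); last by apply: ZL1 => //; exact: le_trans st.
rewrite !(infoE _ M0).
have := @relative_entropy_le _ _ R (leb3_sf R) (Z (t - s)) M; apply => //.
- by move=> f; exact: ZL1.
- by move=> a b f g; exact: Zlin.
- by move=> f; exact: Zpos.
- by move=> f; exact: Zcontr.
- exact: Zpos.
Qed.
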